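(* Let $D=(E,\mathcal{F})$ be a delta-matroid and $e\in E$ (in items (1)--(5)). Write $\widetilde R(D):=R(D;x+1,y,1/\sqrt{xy})$. (1) If $e$ is a loop, then $\widetilde R(D)=\widetilde R(D\setminus e)+y\,\widetilde R(D/e)$. (2) If $e$ is a non-trivial, orientable ribbon loop, then $\widetilde R(D)=\widetilde R(D\setminus e)+(y/x)\,\widetilde R(D/e)$. (3) If $e$ is a non-orientable ribbon loop, then $\widetilde R(D)=\widetilde R(D\setminus e)+\sqrt{y/x}\;\widetilde R(D/e)$. (4) If $e$ is a coloop, then $\widetilde R(D)=x\,\widetilde R(D\setminus e)+\widetilde R(D/e)$. (5) If $e$ is not a ribbon loop or a coloop, then $\widetilde R(D)=\widetilde R(D\setminus e)+\widetilde R(D/e)$. (6) $\widetilde R(D)=1$ when $E=\emptyset$.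
   Context: A set system is a pair $D=(E,\mathcal{F})$ with $E$ a finite set and $\mathcal{F}$ a collection of subsets of $E$ (feasible sets). A delta-matroid is a set system with $\mathcal{F}\ne\emptyset$ such that for all $X,Y\in\mathcal{F}$ and $u\in X\bigtriangleup Y$ there is $v\in X\bigtriangleup Y$ (possibly $v=u$) with $X\bigtriangleup\{u,v\}\in\mathcal{F}$, where $\bigtriangleup$ is symmetric difference. The twist is $D*A=(E,\{A\bigtriangleup X:X\in\mathcal{F}\})$; write $D*e$ for $D*\{e\}$. $D_{\min}$ and $D_{\max}$ are the matroids on $E$ whose bases are the feasible sets of $D$ of minimum, respectively maximum, cardinality; $r_{D_{\min}}$ is the rank function of $D_{\min}$. An element $e$ is a coloop of $D$ if it is in every feasible set and a loop of $D$ if it is in no feasible set. If $e$ is not a coloop, $D\setminus e=(E-e,\{F:F\in\mathcal{F},F\subseteq E-e\})$. If $e$ is not a loop, $D/e=(E-e,\{F-e:F\in\mathcal{F},e\in F\})$. If $e$ is a loop or coloop, then one of these has been defined and one sets $D/e=D\setminus e$. $D|A:=D\setminus(E-A)$, deleting elements one at a time (order immaterial). $e$ is a ribbon loop of $D$ if it is a loop of $D_{\min}$. A ribbon loop $e$ of $D$ is non-orientable if $e$ is also a ribbon loop of $D*e$, and orientable otherwise. An orientable ribbon loop is trivial if it is in no feasible set of $D$, and non-trivial otherwise. The Bollob\'as--Riordan polynomial of a delta-matroid is $$R(D;x,y,z)=\sum_{A\subseteq E}(x-1)^{r_{D_{\min}}(E)-r_{D_{\min}}(A)}\,y^{|A|-r_{D_{\min}}(A)}\,z^{r((D|A)_{\max})-r((D|A)_{\min})}.$$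 Square roots are formal and chosen compatibly: $\sqrt{xy}=\sqrt{x}\sqrt{y}$ and $\sqrt{y/x}=\sqrt{y}/\sqrt{x}$. *)

(* Defs.v *)
From mathcomp Require Import all_boot all_order all_algebra.
From mathcomp Require Import mpoly.

Set Implicit Arguments.
Unset Strict Implicit.
Unset Printing Implicit Defensive.

Import GRing.Theory.
Local Open Scope ring_scope.

Section SetSystems.

Variable T : finType.

(* Ground sets are finite subsets of an ambient finite type, so that deletion
   and contraction do not change types. That the feasible sets are subsets of
   the ground set is required in [delta_matroid] and preserved by every
   operation below. *)
Record set_system := SetSystem {
  ground : {set T};
  feasible : {set {set T}}
}.

Definition symdiff (A B : {set T}) : {set T} := (A :\: B) :|: (B :\: A).

Definition delta_matroid (D : set_system) : Prop :=
  [/\ forall X, X \in feasible D -> X \subset ground D,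
      feasible D != set0
    & forall X Y, X \in feasible D -> Y \in feasible D ->
      forall u, u \in symdiff X Y ->
      exists2 v, v \in symdiff X Y & symdiff X [set u; v] \in feasible D].

Definition twist (D : set_system) (A : {set T}) : set_system :=
  SetSystem (ground D) [set symdiff A X | X in feasible D].

Definition Dmin (D : set_system) : set_system :=
  SetSystem (ground D)
    [set X in feasible D | [forall Y in feasible D, (#|X| <= #|Y|)%N]].

Definition Dmax (D : set_system) : set_system :=
  SetSystem (ground D)
    [set X in feasible D | [forall Y in feasible D, (#|Y| <= #|X|)%N]].

(* The rank function of a matroid given by its bases: the size of a largest
   intersection of A with a basis. *)
Definition rank_of (M : set_system) (A : {set T}) : nat :=
  \max_(B in feasible M) #|A :&: B|.

Definition rank (M : set_system) : nat := rank_of M (ground M).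

Definition is_loop (D : set_system) (e : T) : bool :=
  [forall X in feasible D, e \notin X].

Definition is_coloop (D : set_system) (e : T) : bool :=
  [forall X in feasible D, e \in X].

Definition avoiding (D : set_system) (e : T) : set_system :=
  SetSystem (ground D :\ e) [set X in feasible D | X \subset ground D :\ e].

Definition containing (D : set_system) (e : T) : set_system :=
  SetSystem (ground D :\ e) [set X :\ e | X in feasible D & e \in X].

(* D \ e; for a coloop it is, by convention, D / e. *)
Definition delete (D : set_system) (e : T) : set_system :=
  if is_coloop D e then containing D e else avoiding D e.

(* D / e; for a loop it is, by convention, D \ e. *)
Definition contract (D : set_system) (e : T) : set_system :=
  if is_loop D e then avoiding D e else containing D e.

(* The elements outside A are deleted one at a time, in the order of [enum];
   for a delta-matroid the order is immaterial. *)
Definition restrict (D : set_system) (A : {set T}) : set_system :=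
  foldl delete D (enum (ground D :\: A)).

Definition ribbon_loop (D : set_system) (e : T) : bool := is_loop (Dmin D) e.

Definition nonorientable_ribbon_loop (D : set_system) (e : T) : bool :=
  ribbon_loop D e && ribbon_loop (twist D [set e]) e.

Definition orientable_ribbon_loop (D : set_system) (e : T) : bool :=
  ribbon_loop D e && ~~ nonorientable_ribbon_loop D e.

Definition trivial_orientable_ribbon_loop (D : set_system) (e : T) : bool :=
  orientable_ribbon_loop D e && is_loop D e.

Definition nontrivial_orientable_ribbon_loop (D : set_system) (e : T) : bool :=
  orientable_ribbon_loop D e && ~~ trivial_orientable_ribbon_loop D e.

(* The indeterminates x, y, z are 'X_0, 'X_1, 'X_2. For a delta-matroid none of
   the natural-number subtractions in the exponents is truncated. *)
Definition BR (D : set_system) : {mpoly int[3]} :=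
  \sum_(A in powerset (ground D))
    ('X_(inord 0) - 1) ^+ (rank_of (Dmin D) (ground D) - rank_of (Dmin D) A)
    * 'X_(inord 1) ^+ (#|A| - rank_of (Dmin D) A)
    * 'X_(inord 2) ^+ (rank (Dmax (restrict D A)) - rank (Dmin (restrict D A))).

(* The value R(D; x, y, z) of the polynomial in a commutative ring. *)
Definition BReval (K : comUnitRingType) (D : set_system) (x y z : K) : K :=
  mmap intr (tnth [tuple x; y; z]) (BR D).

End SetSystems.

(* Main.v *)
Require Import Defs.
From mathcomp Require Import all_boot all_order all_algebra.
From mathcomp Require Import zify ring mpoly.
Import GRing.Theory.

(** Write [d(A)] for the distance from [A] to the family of feasible sets, that
    is, the least size of [symdiff A F] over the feasible sets [F]; in
    particular [d(set0)] is the rank of [Dmin D]. The point is that under the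
    substitution [(x, y, z) := (x + 1, y, 1 / sqrt (xy))] the whole
    Bollobas-Riordan polynomial is a generating function of this distance.
    Put [t = sy / sx] and [u = sx * sy], so that [x = u / t] and [y = u * t].
    The minimum and maximum ranks of the restriction to [A] add up to
    [#|A| + d(set0) - d(A)], while the minimum one is the rank of [A] in
    [Dmin D] ([restrict_spec]). Hence the exponents of [t] and [u] collapse and
    ([BReval_dist_gf])

      [t ^ d(set0) * R(D; x + 1, y, 1 / u) = \sum_(A) t ^ #|A| * u ^ d(A)].

    The right-hand side splits according to whether [e] belongs to [A]
    ([dist_gf_split]). By the exchange axiom, a nearest feasible set to [A] can
    be chosen to agree with [A] about [e] as soon as some feasible set does
    ([dist_attained_side]). So for [e] outside [A] the distance is computed in
    [delete D e], up to one extra unit when [e] is a coloop, and dually for [e]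
    inside [A] with [contract D e] and loops ([dist_delete], [dist_contract]).

    The five deletion-contraction identities are therefore one identity; they
    differ only in the normalising power of [t]. For the deletion it is
    governed by [d(set0)], and for the contraction by [d([set e])], which
    differs from [d(set0)] by at most one: the difference is [-1] exactly when
    [e] is not a ribbon loop, [0] exactly when [e] is a non-orientable ribbon
    loop, and [1] when [e] is an orientable one ([ribbon_loop_dist],
    [nonorientable_ribbon_loop_dist]). This accounts for the coefficients
    [1], [t = sqrt (y / x)] and [t ^ 2 = y / x]. The extra unit of
    distance contributes a factor [u], which gives the coefficient [t * u = y]
    of the contraction of a loop and [u / t = x] of the deletion of a coloop. *)

(** * Distance to the feasible sets *)

Set Implicit Arguments.
Unset Strict Implicit.

Local Open Scope nat_scope.

Section Distance.

Variable T : finType.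
Implicit Types (D : set_system T) (A B F X Y : {set T}) (e u v : T) (b : bool).

Lemma in_symdiff A B u : (u \in symdiff A B) = (u \in A) (+) (u \in B).
Proof. by rewrite !inE; case: (u \in A); case: (u \in B). Qed.

Lemma symdiff_setD1 A B e : symdiff (A :\ e) (B :\ e) = symdiff A B :\ e.
Proof.
by apply/setP => u; rewrite in_setD1 !in_symdiff !in_setD1; case: (u == e).
Qed.

Lemma card_symdiff_split e A B :
  #|symdiff A B| =
  ((e \in A) != (e \in B)) + #|symdiff (A :\ e) (B :\ e)|.
Proof.
by rewrite (cardsD1 e) in_symdiff negb_eqb symdiff_setD1.
Qed.

(** Toggling [u], on which [A] and [F] disagree, gains one unit, and toggling
    a second element costs at most one: an exchange never moves a feasible set
    away from [A]. *)
Lemma card_symdiff_pair_le F A u v :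
  u \in symdiff A F -> #|symdiff A (symdiff F [set u; v])| <= #|symdiff A F|.
Proof.
move=> uAF; rewrite [leqRHS](cardsD1 u) uAF addnC.
apply: leq_trans (_ : #|(symdiff A F :\ u) :|: [set v]| <= _); last first.
  by apply: leq_trans (leq_card_setU _ _) _; rewrite cards1.
apply/subset_leq_card/subsetP => w.
move: uAF; rewrite in_setU in_set1 in_setD1 !in_symdiff in_set2.
by have [->|_] := eqVneq w u; case: (_ == v); rewrite ?addbF ?orbT ?orbF //=;
  case: (_ \in A); case: (_ \in F).
Qed.

(** The index [#|T|] is an upper bound of all the distances, hence a neutral
    default for the minimum. *)
Definition dist D A : nat :=
  \big[Order.min/#|T|]_(F in feasible D) #|symdiff A F|.

Lemma dist_le D A F : F \in feasible D -> dist D A <= #|symdiff A F|.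
Proof.
by move=> FD; rewrite -leEnat; apply: Order.TotalTheory.bigmin_le_cond.
Qed.

Lemma dist_attained D A :
  feasible D != set0 -> exists2 F, F \in feasible D & dist D A = #|symdiff A F|.
Proof.
case/set0Pn => F0 F0D.
have hT F : F \in feasible D -> (#|symdiff A F| <= #|T|)%O.
  by rewrite leEnat max_card.
by have [F FD dF] := Order.TotalTheory.eq_bigmin _ _ _ F0D hT; exists F.
Qed.

Lemma dist_eq D A F :
    F \in feasible D ->
    (forall G, G \in feasible D -> #|symdiff A F| <= #|symdiff A G|) ->
  dist D A = #|symdiff A F|.
Proof.
move=> FD minF; apply/eqP; rewrite eqn_leq dist_le //=.
have [|G GD ->] := @dist_attained D A; last exact: minF.
by apply/set0Pn; exists F.
Qed.

Lemma symdiff0 A : symdiff set0 A = A.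
Proof. by apply/setP => u; rewrite in_symdiff inE. Qed.

Lemma feasible_neq0 D : delta_matroid D -> feasible D != set0.
Proof. by case. Qed.

(** If a nearest [F] is on the wrong side of [e], exchanging [e] against [Y]
    yields a set that is no farther from [A]; even if the element [v] given by
    the axiom is [e] itself, [e] is toggled exactly once. *)
Lemma dist_attained_side D A Y e :
    delta_matroid D -> Y \in feasible D -> (e \in Y) = (e \in A) ->
  exists F, [/\ F \in feasible D, (e \in F) = (e \in A) &
                dist D A = #|symdiff A F|].
Proof.
move=> hD YD eY; have [F FD dF] := dist_attained A (feasible_neq0 hD).
have [eF|eF] := eqVneq (e \in F) (e \in A); first by exists F.
have eFY : e \in symdiff F Y by rewrite in_symdiff eY -negb_eqb.
have eAF : e \in symdiff A F by rewrite in_symdiff -negb_eqb eq_sym.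
have [_ _ exch] := hD.
have [v vFY F'D] := exch F Y FD YD e eFY.
exists (symdiff F [set e; v]); split=> //.
  rewrite in_symdiff set21; move: eF.
  by case: (e \in F); case: (e \in A).
apply/eqP; rewrite eqn_leq dist_le //= dF.
exact: card_symdiff_pair_le.
Qed.

(** * Deletion and contraction *)

(** Deletion and contraction, together with their conventions for loops and
    coloops, are two instances of one operation: keep the feasible sets on a
    prescribed side of [e] and forget [e]. Deletion chooses the side avoiding
    [e] whenever it is inhabited, and contraction the side containing [e]. *)
Definition slice D e b : set_system T :=
  SetSystem (ground D :\ e) [set X :\ e | X in feasible D & (e \in X) == b].

Lemma slice_containing D e : slice D e true = containing D e.
Proof.
congr SetSystem; apply/setP => G.
apply/imsetP/imsetP => -[X]; rewrite inE => /andP[XD eX] ->;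
  by exists X; rewrite // inE ?eqb_id XD // eqb_id in eX *.
Qed.

Lemma sliceP D e b G :
  reflect (exists X, [/\ X \in feasible D, (e \in X) = b & G = X :\ e])
          (G \in feasible (slice D e b)).
Proof.
apply: (iffP imsetP) => [[X]|[X [XD eX ->]]].
  by rewrite !inE => /andP[XD /eqP eX] ->; exists X.
by exists X; rewrite // !inE XD eX eqxx.
Qed.

Lemma slice_avoiding D e :
  delta_matroid D -> slice D e false = avoiding D e.
Proof.
move=> [subD _ _]; congr SetSystem; apply/setP => G.
apply/sliceP/idP => [[X [XD eX ->]]|].
  have XE : X :\ e = X by apply/setDidPl; rewrite disjoint_sym disjoints1 eX.
  by rewrite XE inE XD subsetD1 eX subD.
rewrite inE subsetD1 => /and3P[GD _ eG]; exists G; split=> //.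
  exact: negbTE.
by apply/esym/setDidPl; rewrite disjoint_sym disjoints1.
Qed.


(** The element [v] exchanged for some [u != e] is never [e], because both
    sets lie on the same side of [e]; so the exchange stays in the slice. *)
Lemma slice_delta_matroid D e b Y :
    delta_matroid D -> Y \in feasible D -> (e \in Y) = b ->
  delta_matroid (slice D e b).
Proof.
move=> hD YD eY; have [subD _ exch] := hD; split=> /=.
- by move=> _ /sliceP[X [XD _ ->]]; apply/setSD/subD.
- by apply/set0Pn; exists (Y :\ e); apply/sliceP; exists Y.
move=> _ _ /sliceP[X [XD eX ->]] /sliceP[Z [ZD eZ ->]] u.
rewrite symdiff_setD1 in_setD1 => /andP[ue uXZ].
have [v vXZ WD] := exch X Z XD ZD u uXZ.
have ve : v != e by apply: contraL vXZ => /eqP->;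
  rewrite in_symdiff eX eZ addbb.
exists v; first by rewrite in_setD1 ve.
apply/sliceP; exists (symdiff X [set u; v]); split=> //.
  by rewrite in_symdiff in_set2 !(eq_sym e) (negbTE ue) (negbTE ve) addbF.
rewrite -symdiff_setD1; congr symdiff.
by apply/esym/setDidPl;
  rewrite disjoint_sym disjoints1 in_set2 !(eq_sym e) negb_or ue.
Qed.

(** When [A] is on side [b] a nearest set can be found in the slice; when no
    feasible set is on the side of [A], each of them pays one unit at [e]. *)
Lemma dist_slice D A e b Y :
    delta_matroid D -> Y \in feasible D -> (e \in Y) = b ->
    b = (e \in A) \/ (forall F, F \in feasible D -> (e \in F) = b) ->
  dist D A = dist (slice D e b) (A :\ e) + (b != (e \in A)).
Proof.
move=> hD YD eY side.
have [F [FD eF dF]] : exists F,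
    [/\ F \in feasible D, (e \in F) = b & dist D A = #|symdiff A F|].
  case: side => [bA|allb].
    by rewrite bA; apply: (@dist_attained_side _ _ Y); rewrite ?eY.
  have [F FD dF] := dist_attained A (feasible_neq0 hD).
  by exists F; rewrite allb.
have FS : F :\ e \in feasible (slice D e b) by apply/sliceP; exists F.
rewrite (dist_eq FS) => [|_ /sliceP[G [GD eG ->]]].
  by rewrite dF (card_symdiff_split e) eF eq_sym addnC.
have := dist_le A GD.
rewrite dF (card_symdiff_split e A F) (card_symdiff_split e A G).
by rewrite eF eG leq_add2l.
Qed.

Lemma loop_in D e F : is_loop D e -> F \in feasible D -> e \notin F.
Proof. by move=> /forall_inP h /h. Qed.

Lemma coloop_in D e F : is_coloop D e -> F \in feasible D -> e \in F.
Proof. by move=> /forall_inP h /h. Qed.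

Lemma delete_slice D e :
  delta_matroid D -> delete D e = slice D e (is_coloop D e).
Proof.
by move=> hD; rewrite /delete; case: ifP;
  rewrite ?slice_containing ?slice_avoiding.
Qed.

Lemma contract_slice D e :
  delta_matroid D -> contract D e = slice D e (~~ is_loop D e).
Proof.
by move=> hD; rewrite /contract; case: ifP;
  rewrite ?slice_containing ?slice_avoiding.
Qed.

Lemma delete_side D e :
  delta_matroid D -> exists2 Y, Y \in feasible D & (e \in Y) = is_coloop D e.
Proof.
move=> /feasible_neq0/set0Pn[F FD]; case: (boolP (is_coloop D e)) => [co|].
  by exists F; rewrite // (coloop_in co).
by case/forall_inPn => Y YD /negbTE eY; exists Y.
Qed.

Lemma contract_side D e :
  delta_matroid D -> exists2 Y, Y \in feasible D & (e \in Y) = ~~ is_loop D e.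
Proof.
move=> /feasible_neq0/set0Pn[F FD]; case: (boolP (is_loop D e)) => [lo|].
  by exists F; rewrite // (negbTE (loop_in lo FD)).
by case/forall_inPn => Y YD; rewrite negbK => eY; exists Y.
Qed.

Lemma delete_delta_matroid D e : delta_matroid D -> delta_matroid (delete D e).
Proof.
move=> hD; have [Y YD eY] := delete_side e hD.
by rewrite delete_slice //; apply: (slice_delta_matroid hD YD).
Qed.

Lemma contract_delta_matroid D e :
  delta_matroid D -> delta_matroid (contract D e).
Proof.
move=> hD; have [Y YD eY] := contract_side e hD.
by rewrite contract_slice //; apply: (slice_delta_matroid hD YD).
Qed.

Lemma dist_delete D A e :
    delta_matroid D -> e \notin A ->
  dist D A = dist (delete D e) A + is_coloop D e.
Proof.
move=> hD eA; have [Y YD eY] := delete_side e hD.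
rewrite delete_slice // (dist_slice hD YD eY) ?(negbTE eA) => [|].
  congr (dist _ _ + _); last by case: (is_coloop _ _).
  by apply/setDidPl; rewrite disjoint_sym disjoints1.
case: (boolP (is_coloop D e)) => [co|_]; [right=> F FD | by left].
exact: (coloop_in co).
Qed.

Lemma dist_contract D A e :
    delta_matroid D -> e \notin A ->
  dist D (e |: A) = dist (contract D e) A + is_loop D e.
Proof.
move=> hD eA; have [Y YD eY] := contract_side e hD.
rewrite contract_slice // (dist_slice hD YD eY) ?setU11 => [|].
  by rewrite setU1K //; case: (is_loop _ _).
case: (boolP (is_loop D e)) => [lo|_]; [right=> F FD | by left].
exact: (negbTE (loop_in lo FD)).
Qed.

(** * Ranks in terms of the distance *)

Lemma mem_Dmin D F :
    feasible D != set0 ->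
  (F \in feasible (Dmin D)) = (F \in feasible D) && (#|F| == dist D set0).
Proof.
move=> D0; rewrite inE; apply: andb_id2l => FD; apply/forall_inP/eqP =>
  [minF|Fd].
  by rewrite (dist_eq FD) ?symdiff0 // => G /minF; rewrite !symdiff0.
by move=> G GD; rewrite Fd -(symdiff0 G) dist_le.
Qed.

Lemma subset_ground D F : delta_matroid D -> F \in feasible D ->
  F \subset ground D.
Proof. by case=> + _ _; apply. Qed.

Lemma rank_Dmin D : delta_matroid D -> rank (Dmin D) = dist D set0.
Proof.
move=> hD; have [F FD dF] := dist_attained set0 (feasible_neq0 hD).
rewrite symdiff0 in dF.
apply/eqP; rewrite eqn_leq; apply/andP; split.
  apply/bigmax_leqP => G; rewrite mem_Dmin ?feasible_neq0 // => /andP[_ /eqP<-].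
  exact/subset_leq_card/subsetIr.
rewrite dF; apply: (bigmax_sup F).
  by rewrite mem_Dmin ?feasible_neq0 // FD dF /=.
by rewrite /= (setIidPr (subset_ground hD FD)).
Qed.

Lemma card_symdiff_subset A F : F \subset A -> #|symdiff A F| + #|F| = #|A|.
Proof.
move=> sFA; have /eqP FA0 : F :\: A == set0 by rewrite setD_eq0.
rewrite /symdiff FA0 setU0.
by rewrite cardsD (setIidPr sFA) subnK // subset_leq_card.
Qed.

Lemma rank_Dmax D :
  delta_matroid D -> rank (Dmax D) + dist D (ground D) = #|ground D|.
Proof.
move=> hD; have [F FD dF] := dist_attained (ground D) (feasible_neq0 hD).
have cF := card_symdiff_subset (subset_ground hD FD).
rewrite -dF in cF.
suff -> : rank (Dmax D) = #|F| by rewrite addnC.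
have maxF G : G \in feasible D -> #|G| <= #|F|.
  move=> GD; have := dist_le (ground D) GD.
  have := card_symdiff_subset (subset_ground hD GD); lia.
apply/eqP; rewrite eqn_leq; apply/andP; split.
  apply/bigmax_leqP => G; rewrite inE => /andP[GD _].
  by apply: leq_trans (maxF G GD); apply/subset_leq_card/subsetIr.
apply: (bigmax_sup F); first by rewrite inE FD; apply/forall_inP.
by rewrite /= (setIidPr (subset_ground hD FD)).
Qed.

Lemma rank_Dmin_le_Dmax D : delta_matroid D -> rank (Dmin D) <= rank (Dmax D).
Proof.
move=> hD; have [F FD dF] := dist_attained set0 (feasible_neq0 hD).
have := rank_Dmax hD; have := dist_le (ground D) FD.
have := card_symdiff_subset (subset_ground hD FD).
rewrite rank_Dmin // dF symdiff0; lia.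
Qed.

(** If a minimum feasible set contains [e] and [e] is not a coloop, exchanging
    [e] against a feasible set avoiding [e] swaps it for an outside element [v]
    (removing elements would contradict minimality). The result still meets
    [A] in at least as many elements, since [e] is not in [A]. *)
Lemma rank_of_delete D A e :
    delta_matroid D -> e \notin A ->
  rank_of (Dmin (delete D e)) A = rank_of (Dmin D) A.
Proof.
move=> hD eA; have hD' := delete_delta_matroid e hD.
have dist0 : dist D set0 = dist (delete D e) set0 + is_coloop D e.
  by apply: dist_delete; rewrite ?inE.
have AI F : A :&: (F :\ e) = A :&: F.
  apply/setP => u; rewrite !inE; case: eqVneq => // ->.
  by rewrite (negbTE eA).
have delmin F : F \in feasible (Dmin D) -> (e \in F) = is_coloop D e ->
    F :\ e \in feasible (Dmin (delete D e)).
  rewrite !mem_Dmin ?feasible_neq0 // => /andP[FD /eqP cF] eF; apply/andP;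
    split.
    by rewrite delete_slice //; apply/sliceP; exists F.
  by move: cF; rewrite dist0 (cardsD1 e F) eF => /eqP; rewrite addnC eqn_add2r.
apply/eqP; rewrite eqn_leq; apply/andP; split; apply/bigmax_leqP => G.
  rewrite mem_Dmin ?feasible_neq0 // {1}delete_slice // =>
    /andP[/sliceP[F [FD eF ->]] /eqP cF].
  apply: (bigmax_sup F); last by rewrite AI.
  by rewrite mem_Dmin ?feasible_neq0 // FD (cardsD1 e) eF cF dist0 addnC /=.
move=> Gmin; have [eG|eG] := eqVneq (e \in G) (is_coloop D e).
  by apply: (bigmax_sup (G :\ e)); rewrite ?AI ?delmin.
move: (Gmin); rewrite mem_Dmin ?feasible_neq0 // => /andP[GD /eqP cG].
have [Y YD eY] := delete_side e hD.
have [co|nco] := boolP (is_coloop D e).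
  by case/negP: eG; rewrite co (coloop_in co).
rewrite (negbTE nco) in eY eG; have {}eG : e \in G by case: (e \in G) eG.
have [_ _ exch] := hD.
have eGY : e \in symdiff G Y by rewrite in_symdiff eG eY.
have [v vGY HD] := exch G Y GD YD e eGY.
pose H := symdiff G [set e; v].
have cH : #|G| <= #|H| by rewrite cG -(symdiff0 H) dist_le.
(* otherwise [H] would be strictly smaller than the minimum feasible set [G] *)
have vG : v \notin G.
  apply: contraL cH => vG; rewrite -ltnNge; apply: proper_card.
  rewrite properE; apply/andP; split; last first.
    by apply/subsetPn; exists e; rewrite // in_symdiff eG set21.
  apply/subsetP => w; rewrite in_symdiff in_set2.
  by case: eqVneq => [->|_]; case: eqVneq => [->|_]; rewrite ?eG ?vG ?addbF.
have HE : H = v |: (G :\ e).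
  apply/setP => w; rewrite in_symdiff in_set2 in_setU1 in_setD1.
  case: (eqVneq w e) => [->|_]; last by case: eqVneq => [->|_];
    rewrite ?(negbTE vG) ?addbF.
  by rewrite eG orbF; apply/esym/negbTE/eqP => ev; rewrite -ev eG in vG.
have Hmin : H \in feasible (Dmin D).
  rewrite mem_Dmin ?feasible_neq0 // HD HE cardsU1 in_setD1.
  by rewrite (negbTE vG) andbF -cG (cardsD1 e G) eG eqxx.
have eH : (e \in H) = is_coloop D e.
  by rewrite in_symdiff eG set21 (negbTE nco).
rewrite /rank_of; apply: (bigmax_sup (H :\ e)); first exact: delmin.
rewrite AI HE -AI; apply/subset_leq_card/setIS/subsetUr.
Qed.

(** Each deletion shifts all the distances of the sets that remain by the same
    amount, so a sequence of deletions in any order is controlled by a single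
    constant [c]. *)
Lemma deletions_spec D (s : seq T) :
    delta_matroid D -> uniq s -> {subset s <= ground D} ->
  let D' := foldl (@delete T) D s in
  [/\ delta_matroid D', ground D' = ground D :\: [set:: s],
      forall A, [disjoint A & s] -> rank_of (Dmin D') A = rank_of (Dmin D) A
    & exists c, forall A, [disjoint A & s] -> dist D A = dist D' A + c].
Proof.
elim: s D => [|e s IHs] D hD /=.
  move=> _ _; split=> //; first by rewrite set_nil setD0.
  by exists 0 => A _; rewrite addn0.
case/andP=> es us sD.
have gde : ground (delete D e) = ground D :\ e by rewrite delete_slice.
have [|hD' gD' rkD' [c distD']] := IHs _ (delete_delta_matroid e hD) us.
  move=> u us'; rewrite gde in_setD1 sD ?inE ?us' ?orbT // andbT.
  by apply: contraNneq es => <-.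
split=> //.
- by rewrite gD' gde set_cons setDDl.
- move=> A; rewrite disjoint_sym disjoint_cons disjoint_sym => /andP[eA As].
  by rewrite rkD' // rank_of_delete.
exists (c + is_coloop D e) => A.
rewrite disjoint_sym disjoint_cons disjoint_sym => /andP[eA As].
by rewrite addnA -distD' // -dist_delete.
Qed.

(** In [restrict D A], whose ground set is [A], the minimum rank is the distance
    from [set0] and the maximum rank is [#|A|] minus the distance from [A]. In
    their sum the constant shift between the distances of [D] and those of
    [restrict D A] cancels. *)
Lemma restrict_spec D A :
    delta_matroid D -> A \subset ground D ->
  [/\ rank (Dmin (restrict D A)) = rank_of (Dmin D) A,
      rank (Dmin (restrict D A)) <= rank (Dmax (restrict D A))
    & rank (Dmax (restrict D A)) + rank (Dmin (restrict D A)) + dist D A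
      = #|A| + dist D set0].
Proof.
move=> hD sA.
have dis : [disjoint A & enum (ground D :\: A)].
  rewrite disjoint_subset; apply/subsetP => u uA.
  by rewrite inE mem_enum in_setD uA.
have [||hD' gD' rkD' [c distD']] :=
  @deletions_spec D (enum (ground D :\: A)) hD.
- exact: enum_uniq.
- by move=> u; rewrite mem_enum inE => /andP[].
have gA : ground (restrict D A) = A.
  rewrite gD'; apply/setP => u; rewrite !inE mem_enum !inE.
  by have /subsetP/(_ u) := sA; case: (u \in A) => [->|] //;
    case: (u \in ground D).
split; [by rewrite /rank gA rkD' | exact: rank_Dmin_le_Dmax |].
have dis0 : [disjoint set0 & enum (ground D :\: A)].
  by rewrite disjoint_subset; apply/subsetP => u; rewrite inE.
have := rank_Dmax hD'; rewrite (distD' A) // (distD' set0) // -/(restrict D A).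
rewrite rank_Dmin // gA; lia.
Qed.

(** * Ribbon loops in terms of the distance *)

Lemma card_symdiff_set1 e F :
  #|symdiff [set e] F| + (e \in F) = #|F| + (e \notin F).
Proof.
rewrite (card_symdiff_split e) set11 setDv symdiff0 (cardsD1 e F).
by case: (e \in F) => /=; lia.
Qed.

(** A feasible set [F] has distance [#|F| - 1] or [#|F| + 1] from [set e],
    according to whether it contains [e]. So [set e] is closer than [set0]
    exactly when a minimum feasible set contains [e]. *)
Lemma ribbon_loop_dist D e :
  feasible D != set0 -> ribbon_loop D e = (dist D set0 <= dist D [set e]).
Proof.
move=> D0; apply/forall_inP/idP => [minD|le_d F].
  have [F FD dF] := dist_attained [set e] D0.
  rewrite leqNgt; apply/negP => lt_d.
  have := card_symdiff_set1 e F; have := dist_le set0 FD; rewrite symdiff0.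
  have [eF|eF] := boolP (e \in F); last by rewrite -dF /=; lia.
  rewrite -dF /= => le_dF cF; have : F \in feasible (Dmin D).
    by rewrite mem_Dmin // FD /=; apply/eqP; lia.
  by move/minD; rewrite eF.
rewrite mem_Dmin // => /andP[FD /eqP dF]; apply/negP => eF.
have := card_symdiff_set1 e F; have := dist_le [set e] FD.
rewrite eF /= dF; lia.
Qed.

Lemma dist_twist D A B :
  feasible D != set0 -> dist (twist D A) B = dist D (symdiff A B).
Proof.
move=> D0; have [F FD dF] := dist_attained (symdiff A B) D0.
have sAB G : symdiff B (symdiff A G) = symdiff (symdiff A B) G.
  by apply/setP => w; rewrite !in_symdiff addbCA addbA.
rewrite dF -sAB; apply: dist_eq => [|_ /imsetP[G GD ->]]; first exact: imset_f.
by rewrite !sAB -dF dist_le.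
Qed.

(** Twisting by [e] exchanges the distances from [set0] and from [set e], so
    the two ribbon loop conditions are opposite inequalities. *)
Lemma nonorientable_ribbon_loop_dist D e :
    feasible D != set0 ->
  nonorientable_ribbon_loop D e = (dist D [set e] == dist D set0).
Proof.
move=> D0; have D0' : feasible (twist D [set e]) != set0.
  by case/set0Pn: D0 => F FD; apply/set0Pn; exists (symdiff [set e] F);
    apply: imset_f.
rewrite /nonorientable_ribbon_loop !ribbon_loop_dist // !dist_twist //.
have -> : symdiff [set e] set0 = [set e].
  by apply/setP => w; rewrite in_symdiff in_set0 addbF.
have -> : symdiff [set e] [set e] = set0.
  by apply/setP => w; rewrite in_symdiff addbb inE.
by rewrite -eqn_leq eq_sym.
Qed.

Lemma dist_set1_near D e :
    feasible D != set0 ->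
  dist D [set e] <= (dist D set0).+1 /\ dist D set0 <= (dist D [set e]).+1.
Proof.
move=> D0; have [F FD dF] := dist_attained [set e] D0.
have [G GD dG] := dist_attained set0 D0.
have := dist_le set0 FD; have := dist_le [set e] GD.
have := card_symdiff_set1 e F; have := card_symdiff_set1 e G.
rewrite !symdiff0 in dG *; case: (e \in F); case: (e \in G) => /=; lia.
Qed.

Lemma delete_contract_loop D e :
  delta_matroid D -> is_loop D e ->
  is_coloop D e = false /\ delete D e = contract D e.
Proof.
move=> hD lo; have nco : is_coloop D e = false.
  have /set0Pn[F FD] := feasible_neq0 hD.
  by apply: contraNF (loop_in lo FD) => /coloop_in; apply.
by rewrite delete_slice // contract_slice // nco lo.
Qed.

Lemma delete_contract_coloop D e :
  delta_matroid D -> is_coloop D e ->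
  is_loop D e = false /\ delete D e = contract D e.
Proof.
move=> hD co; have nlo : is_loop D e = false.
  have /set0Pn[F FD] := feasible_neq0 hD.
  by apply: contraTF (coloop_in co FD) => /loop_in; apply.
by rewrite delete_slice // contract_slice // nlo co.
Qed.

End Distance.

(** * The polynomial as a generating function *)

Local Close Scope nat_scope.
Local Open Scope ring_scope.

Section Polynomial.

Variables (T : finType) (K : comUnitRingType).
Implicit Types (D : set_system T) (e : T) (x y z t u : K).

Lemma BReval_sum D x y z :
  BReval D x y z =
  \sum_(A in powerset (ground D))
    (x - 1) ^+ (rank_of (Dmin D) (ground D) - rank_of (Dmin D) A)
    * y ^+ (#|A| - rank_of (Dmin D) A)
    * z ^+ (rank (Dmax (restrict D A)) - rank (Dmin (restrict D A))).
Proof.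
rewrite /BReval /BR raddf_sum; apply: eq_bigr => A _ /=.
by rewrite !rmorphM !rmorphXn rmorphB rmorph1 /= !mmapX !mmap1U
  !(tnth_nth 0) !inordK.
Qed.

Definition dist_gf D t u : K :=
  \sum_(A in powerset (ground D)) t ^+ #|A| * u ^+ dist D A.

(** With [a], [b] and [w] the exponents of [u / t], [u * t] and [u^-1] in the
    term of [A], the rank identities say that [w + d = a + b], where [d] is the
    distance from [A], and that [b - a = #|A| - dist D set0]. The term is then
    [u ^ (a + b - w) * t ^ (b - a)], whose exponent of [u] is [d]. *)
Lemma BReval_dist_gf D t u :
    delta_matroid D -> t \is a GRing.unit -> u \is a GRing.unit ->
  t ^+ dist D set0 * BReval D (u / t + 1) (u * t) u^-1 = dist_gf D t u.
Proof.
move=> hD tU uU; rewrite BReval_sum mulr_sumr; apply: eq_bigr => A.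
rewrite powersetE => sA.
have [rmin rle rsum] := restrict_spec hD sA.
have r0 : rank_of (Dmin D) (ground D) = dist D set0 := rank_Dmin hD.
have rA : (rank_of (Dmin D) A <= dist D set0)%N.
  rewrite -r0; apply/bigmax_leqP => F FD; apply: (bigmax_sup F) => //.
  exact/subset_leq_card/setSI.
have cA : (rank_of (Dmin D) A <= #|A|)%N.
  by apply/bigmax_leqP => F FD; apply/subset_leq_card/subsetIl.
rewrite addrK r0; move: rsum rle; rewrite rmin.
move: (rank_of _ _) (rank _) (dist D A) (dist D set0) #|A|%N rA cA => r m d k n.
move=> /subnKC <- /subnKC <-; move: (k - r)%N (n - r)%N => a b rsum rle.
rewrite !addKn; have {rsum rle} : (m - r + d = a + b)%N by lia.
move: (m - r)%N => w wd.
rewrite !exprMn !exprVn !exprD.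
have uw : u ^+ w * u ^+ d = u ^+ a * u ^+ b by rewrite -!exprD wd.
apply: (mulIr (unitrX w uU)); apply: (mulIr (unitrX a tU)).
transitivity (t ^+ r * t ^+ a * t ^+ b * (u ^+ a * u ^+ b)
    * (t ^- a * t ^+ a) * (u ^- w * u ^+ w)); first by ring.
rewrite !mulVr ?unitrX // -uw; ring.
Qed.

Lemma dist_gf_split D e t u : delta_matroid D -> e \in ground D ->
  dist_gf D t u = u ^+ is_coloop D e * dist_gf (delete D e) t u
                + t * u ^+ is_loop D e * dist_gf (contract D e) t u.
Proof.
move=> hD eD.
have gd : ground (delete D e) = ground D :\ e by rewrite delete_slice.
have gc : ground (contract D e) = ground D :\ e by rewrite contract_slice.
rewrite /dist_gf gd gc (bigID (fun A : {set T} => e \in A)) /= addrC;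
  congr (_ + _).
  rewrite mulr_sumr; apply: eq_big => [A|A /andP[_ eA]].
    by rewrite !powersetE subsetD1.
  by rewrite (dist_delete hD eA) exprD mulrA mulrC.
rewrite mulr_sumr (reindex_onto (fun A => e |: A) (fun A => A :\ e)) /=;
  last first.
  by move=> A /andP[_ eA]; rewrite setD1K.
have P A :
    [&& e |: A \in powerset (ground D), e \in e |: A & (e |: A) :\ e == A] =
    (A \in powerset (ground D :\ e)).
  rewrite !powersetE subUset sub1set eD setU11 subsetD1 /=; congr (_ && _).
  have [eA|eA] := boolP (e \in A); last by rewrite setU1K ?eqxx.
  by apply/eqP => AE; move: eA; rewrite -AE setD11.
apply: eq_big => [A|A]; first by rewrite -P -andbA.
rewrite -andbA P powersetE subsetD1 => /andP[_ eA].
by rewrite (dist_contract hD eA) cardsU1 eA !exprD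
  (mulrC (u ^+ _)) mulrACA.
Qed.

End Polynomial.

Unset Implicit Arguments.
Set Strict Implicit.

(** * Deletion-contraction *)

(* sx and sy are the square roots of x and y; sx * sy and sy / sx are the
   compatible square roots of x * y and y / x. *)
Theorem corollary5p10 (T : finType) (D : set_system T) (hD : delta_matroid D)
    (K : comUnitRingType) (x y sx sy : K)
    (x_unit : x \is a GRing.unit) (y_unit : y \is a GRing.unit)
    (hsx : sx ^+ 2 = x) (hsy : sy ^+ 2 = y) :
  let Rt (D' : set_system T) : K := BReval D' (x + 1) y (1 / (sx * sy)) in
  (forall e : T, e \in ground D ->
    [/\ is_loop D e ->
          Rt D = Rt (delete D e) + y * Rt (contract D e),
        nontrivial_orientable_ribbon_loop D e ->
          Rt D = Rt (delete D e) + (y / x) * Rt (contract D e),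
        nonorientable_ribbon_loop D e ->
          Rt D = Rt (delete D e) + (sy / sx) * Rt (contract D e),
        is_coloop D e ->
          Rt D = x * Rt (delete D e) + Rt (contract D e)
      & ~~ ribbon_loop D e && ~~ is_coloop D e ->
          Rt D = Rt (delete D e) + Rt (contract D e)])
  /\ (ground D = set0 -> Rt D = 1).
Proof.
move=> Rt.
have sxU : sx \is a GRing.unit
  by rewrite -(unitrX_pos sx (isT : (0 < 2)%N)) hsx.
have syU : sy \is a GRing.unit
  by rewrite -(unitrX_pos sy (isT : (0 < 2)%N)) hsy.
pose t := sy / sx; pose u := sx * sy.
have tU : t \is a GRing.unit by rewrite unitrM syU unitrV.
have uU : u \is a GRing.unit by rewrite unitrM sxU.
have tuE : t * u = y by rewrite mulrA divrK // -expr2.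
have xtE : x * t = u by rewrite mulrCA -hsx expr2 mulrK // mulrC.
have xE : u / t = x by rewrite -xtE mulrK.
have RtE D' : delta_matroid D' -> t ^+ dist D' set0 * Rt D' = dist_gf D' t u.
  by move=> hD'; rewrite -(BReval_dist_gf hD') // xE (mulrC u) tuE -div1r.
split=> [e eD|D0]; last first.
  move: (RtE D hD); rewrite /dist_gf D0 powerset0 big_set1.
  have -> : dist D set0 = 0%N.
    have [F FD _] := dist_attained set0 (feasible_neq0 hD).
    have := subset_ground hD FD; rewrite D0 subset0 => /eqP F0.
    by apply/eqP; rewrite -leqn0; have := dist_le set0 FD;
      rewrite symdiff0 F0 cards0.
  by rewrite cards0 !expr0 !mul1r.
have hDd := delete_delta_matroid e hD; have hDc := contract_delta_matroid e hD.
have rd : dist D set0 = (dist (delete D e) set0 + is_coloop D e)%N.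
  by apply: dist_delete; rewrite ?inE.
have rc : dist D [set e] = (dist (contract D e) set0 + is_loop D e)%N.
  by rewrite -dist_contract ?inE ?setU0.
(* the identities are compared after scaling by a power of [t] *)
have tI n : injective ( *%R (t ^+ n)) by apply: mulrI; rewrite unitrX.
have split := RtE D hD; rewrite (dist_gf_split _ _ hD eD) -!RtE // in split.
have sE : sy / sx = t by [].
clearbody t u => {RtE}.
have D0 := feasible_neq0 hD; have [near near'] := dist_set1_near e D0.
have coribbon : is_coloop D e -> ~~ ribbon_loop D e.
  move=> co; have [nlo dc] := delete_contract_coloop hD co.
  by rewrite ribbon_loop_dist // rd rc dc co nlo; lia.
have loribbon : is_loop D e -> ~~ nonorientable_ribbon_loop D e.
  move=> lo; have [nco dc] := delete_contract_loop hD lo.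
  by rewrite nonorientable_ribbon_loop_dist // rd rc dc lo nco; lia.
have loribbon' : is_loop D e -> ribbon_loop D e.
  by move=> lo; apply/forall_inP => F; rewrite inE => /andP[/(loop_in lo)].
split.
- move=> lo; have [nco dc] := delete_contract_loop hD lo.
  apply: (tI (dist D set0));
    rewrite split rd lo nco dc addn0 -tuE /= expr0 expr1.
  by move: (dist _ _) (Rt _) => k R; ring.
- rewrite /nontrivial_orientable_ribbon_loop /trivial_orientable_ribbon_loop.
  case: (boolP (orientable_ribbon_loop D e)) => //= /andP[rl nno] nlo.
  have nco : is_coloop D e = false by apply: contraTF rl.
  move: rl nno rd rc;
    rewrite ribbon_loop_dist // nonorientable_ribbon_loop_dist //.
  rewrite (negbTE nlo) nco !addn0 => rl nno rd rc.
  have rcE : dist (contract D e) set0 = (dist D set0).+1%N by lia.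
  have -> : y / x = t * t by rewrite -tuE -xtE mulrCA mulrC mulKr.
  apply: (tI (dist D set0));
    rewrite split nco (negbTE nlo) rcE -rd exprS /= expr0.
  by move: (dist _ _) (Rt _) (Rt _) => k Rd Rc; ring.
- move=> nno.
  have nlo : is_loop D e = false by apply: contraTF nno.
  have nco : is_coloop D e = false.
    by apply: contraTF nno => /coribbon rl; rewrite negb_and rl.
  move: nno rd rc; rewrite nonorientable_ribbon_loop_dist // nlo nco !addn0.
  move=> /eqP -> rd rc; apply: (tI (dist D set0)).
  rewrite split nco nlo -rd -rc sE /= expr0.
  by move: (dist _ _) (Rt _) (Rt _) => k Rd Rc; ring.
- move=> co; have [nlo dc] := delete_contract_coloop hD co.
  apply: (tI (dist D set0));
    rewrite split rd co nlo dc addn1 exprS /= expr0 expr1 -xtE.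
  by move: (dist _ _) (Rt _) => k R; ring.
case/andP; rewrite ribbon_loop_dist // => nrl /negbTE nco.
have nlo : is_loop D e = false.
  by apply: contraNF nrl => /loribbon'; rewrite ribbon_loop_dist.
move: rd rc; rewrite nlo nco !addn0 => rd rc.
have rE : dist D set0 = (dist (contract D e) set0).+1%N by lia.
apply: (tI (dist D set0)); rewrite split nco nlo -rd rE exprS /= expr0.
by move: (dist _ _) (Rt _) (Rt _) => k Rd Rc; ring.
Qed.
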